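(* Let $\mathcal{M}$ be a generic collection of $5$ lines in $\mathbb{P}^6$ and let $R$ be the coordinate ring of $\mathcal{M}$. Then $R$ is Koszul.
   Context: Let $\mathbb{P}^n$ be projective $n$-space over $\mathbb{C}$ with homogeneous coordinate ring $S=\mathbb{C}[x_0,\ldots,x_n]$ (standard grading); here $n=6$. The defining ideal of a line in $\mathbb{P}^n$ is the ideal of $S$ of all forms vanishing on it; it is minimally generated by $n-1$ linear forms. For a collection $\mathcal{M}=\{\mathcal{L}_1,\ldots,\mathcal{L}_m\}$ of lines with defining ideals $L_1,\ldots,L_m$, the defining ideal of $\mathcal{M}$ is $J=\bigcap_{i=1}^m L_i$ and the coordinate ring of $\mathcal{M}$ is $R=S/J$. The collection $\mathcal{M}$ is a generic collection if the lines are defined by linear forms ($n-1$ linear forms generating each $L_i$) whose coefficients, all taken together, are algebraically independent over $\mathbb{Q}$. A standard graded $\mathbb{C}$-algebra $R$ is Koszul if $\mathbb{C}=R/\mathfrak{m}_R$ (with $\mathfrak{m}_R$ the maximal homogeneous ideal) has a linear free resolution over $R$, i.e. $\mathrm{Tor}_i^R(\mathbb{C},\mathbb{C})_j=0$ for all $i\neq j$. *)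

(* Defs.v *)
From HB Require Import structures.
From mathcomp Require Import all_boot all_order all_algebra.
From mathcomp Require Import ring_quotient.
From mathcomp Require Import boolp reals.
From mathcomp Require Import complex.
From mathcomp Require Import mpoly.

Set Implicit Arguments.
Unset Strict Implicit.
Unset Printing Implicit Defensive.

Import GRing.Theory.
Local Open Scope ring_scope.
Local Open Scope quotient_scope.

Section GeneratedIdeal.
Variable A : comNzRingType.
Implicit Types (G : A -> Prop) (p q : A).

Definition generated_ideal G p : Prop :=
  exists (r : nat) (a g : 'I_r -> A),
    (forall j, G (g j)) /\ p = \sum_j a j * g j.

Lemma generated_ideal0 G : generated_ideal G 0.
Proof.
by exists 0%N, (fun=> 0), (fun=> 0); split=> [[]|] //; rewrite big_ord0.
Qed.

Lemma generated_ideal_linear G a p q :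
  generated_ideal G p -> generated_ideal G q -> generated_ideal G (a * p + q).
Proof.
move=> [r [b [g [Gg ->]]]] [s [c [h [Gh ->]]]].
exists (r + s)%N, (fun j => match split j with inl i => a * b i | inr i => c i end),
  (fun j => match split j with inl i => g i | inr i => h i end).
split=> [j|]; first by case: (split j).
rewrite big_split_ord /= mulr_sumr; congr (_ + _); apply: eq_bigr => i _.
  by rewrite (unsplitK (inl i)) mulrA.
by rewrite (unsplitK (inr i)).
Qed.

End GeneratedIdeal.

Section Lines.
Variables (K : fieldType) (n : nat).

(* A line in P^n is a 2-dimensional linear subspace of K^(n+1); its points are
   the classes of the nonzero vectors of that subspace. *)
Record line := Line {
  line_space :> {vspace 'rV[K]_n.+1};
  dim_line_space : \dim line_space = 2%N }.

Definition vanishes_on (l : line) (f : {mpoly K[n.+1]}) : Prop :=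
  forall v : 'rV[K]_n.+1, v \in line_space l -> v != 0 -> f.@[v 0] = 0.

Definition is_form (f : {mpoly K[n.+1]}) : Prop := exists d, f \is d.-homog.

Definition defining_ideal (l : line) : {mpoly K[n.+1]} -> Prop :=
  generated_ideal (fun f => is_form f /\ vanishes_on l f).

Lemma defining_ideal_vanishes l f : defining_ideal l f -> vanishes_on l f.
Proof.
move=> [r [a [g [Gg ->]]]] v lv v0; rewrite raddf_sum big1 //= => j _.
by rewrite mevalM (proj2 (Gg j) v lv v0) mulr0.
Qed.

Lemma defining_ideal_neq1 l : ~ defining_ideal l 1.
Proof.
move=> /defining_ideal_vanishes l1.
have lN0 : line_space l != 0%VS by rewrite -dimv_eq0 dim_line_space.
have := l1 (vpick l) (memv_pick l); rewrite vpick0 => /(_ lN0).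
by rewrite meval1 => /eqP; rewrite oner_eq0.
Qed.

End Lines.

Section CoordinateRing.
Variables (K : fieldType) (n m : nat).

(* The collection is nonempty (m.+1 lines), so that its ideal is proper and the
   quotient is a nonzero ring. *)
Definition collection_ideal (M : 'I_m.+1 -> line K n) :
    {pred {mpoly K[n.+1]}} :=
  fun p => `[< forall i, defining_ideal (M i) p >].

Lemma collection_ideal_closed M : idealr_closed (collection_ideal M).
Proof.
split=> [||a p q]; rewrite /in_mem /=.
- by apply/asboolP => i; exact: generated_ideal0.
- by apply/negP => /asboolP /(_ ord0); exact: defining_ideal_neq1.
move=> /asboolP Jp /asboolP Jq; apply/asboolP => i.
by apply: generated_ideal_linear; [exact: Jp | exact: Jq].
Qed.

HB.instance Definition _ (M : 'I_m.+1 -> line K n) :=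
  isIdealr.Build _ (collection_ideal M) (collection_ideal_closed M).

Definition coordinate_ring (M : 'I_m.+1 -> line K n) : comNzRingType :=
  {ideal_quot (collection_ideal M)}.

(* The degree d component of S/J is the image of the one of S. *)
Definition coordinate_ring_grading (M : 'I_m.+1 -> line K n)
    (d : nat) (x : coordinate_ring M) : Prop :=
  exists2 p : {mpoly K[n.+1]},
    p \is d.-homog & x = \pi_{ideal_quot (collection_ideal M)} p.

End CoordinateRing.

Arguments coordinate_ring_grading {K n m} M d x.

(* [x] is algebraically independent over Q; the variables of the polynomials
   are indexed by the elements of T through [enum_val]. *)
Definition algebraically_independent (K : numFieldType) (T : finType)
    (x : T -> K) : Prop :=
  forall p : {mpoly rat[#|T|]},
    (map_mpoly ratr p).@[fun k => x (enum_val k)] = 0 :> K -> p = 0.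

Definition linear_form (K : fieldType) (n : nat) (c : 'rV[K]_n.+1) :
    {mpoly K[n.+1]} :=
  \sum_(k < n.+1) c 0 k *: 'X_k.

(* The j-th row of [c i] holds the coefficients of the j-th of the n-1 linear
   forms defining the i-th line. *)
Definition generic_collection (K : numFieldType) (n m : nat)
    (M : 'I_m -> line K n) : Prop :=
  exists c : 'I_m -> 'M[K]_(n.-1, n.+1),
    (forall i p, defining_ideal (M i) p <->
       generated_ideal (fun f => exists j, f = linear_form (row j (c i))) p) /\
    algebraically_independent
      (fun t : 'I_m * 'I_n.-1 * 'I_n.+1 => c t.1.1 t.1.2 t.2).

Section Koszul.
Variables (A : comNzRingType) (gr : nat -> A -> Prop).

(* The maximal homogeneous ideal, i.e. the sum of the components of positive
   degree. *)
Definition irrelevant_ideal (x : A) : Prop :=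
  exists (r : nat) (a : 'I_r -> A),
    (forall d : 'I_r, gr d.+1 (a d)) /\ x = \sum_(d < r) a d.

(* A linear graded free resolution
     ... -> A(-2)^(b 2) -> A(-1)^(b 1) -> A -> A/m -> 0.
   The differential A(-i-1)^(b i.+1) -> A(-i)^(b i) is v |-> v *m D i on row
   vectors; being homogeneous of degree 0 for these shifts means that the
   entries of D i have degree 1.  The last two clauses are exactness at
   A = A^(b 0), where the kernel of A -> A/m is m, and at A^(b i.+1). *)
Definition koszul : Prop :=
  exists (b : nat -> nat) (D : forall i, 'M[A]_(b i.+1, b i)),
    [/\ b 0%N = 1%N,
        forall i r s, gr 1%N (D i r s),
        forall v : 'rV[A]_(b 0%N),
          (forall s, irrelevant_ideal (v 0 s)) <->
          exists w : 'rV[A]_(b 1%N), v = w *m D 0%N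
      & forall i (v : 'rV[A]_(b i.+1)),
          v *m D i = 0 <-> exists w : 'rV[A]_(b i.+2), v = w *m D i.+1].

End Koszul.

(* Main.v *)
(* Write L_i for the ideal of the i-th line and let e_ij be the linear form
   vanishing on the three lines other than the i-th and the j-th; genericity
   makes e_ij and e_ik independent modulo L_i.  In R = S / J the product
   e_ik e_jl vanishes for distinct i, j, k, l, and with {i,j,k,l,m} = {1,...,5}
     (e_kl, e_km, e_lm)             = L_i :&: L_j,
     (e_kl, e_km, e_lm, e_jl, e_jm) = L_i,
   and adding e_ik, or e_ik and e_il, to the latter gives a prime ideal,
   respectively the maximal homogeneous ideal.  Adding the generators one at a
   time, all colon ideals have the same shape, so these ideals form a Koszul
   filtration.  Its syzygies, computed as in Schreyer's theorem, are again
   filtered with the same colon ideals, hence linear.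
   The independence of e_ij and e_ik modulo L_i amounts to a determinant in the
   coefficients of the lines being nonzero, which is the case for suitable
   coordinate lines and therefore for algebraically independent coefficients. *)

From HB Require Import structures.
Require Import Defs.
From mathcomp Require Import all_boot all_order all_algebra.
From mathcomp Require Import ring_quotient boolp reals complex mpoly ring zify.

Set Implicit Arguments.
Unset Strict Implicit.
Unset Printing Implicit Defensive.

Import GRing.Theory.
Local Open Scope ring_scope.

(** * Linear resolutions from Koszul filtrations *)

(** The recursion splits off the generator at the head of the list, the one adjoined last, and so
    follows the order in which a Koszul filtration adds generators. *)
Fixpoint in_ideal (A : comNzRingType) (s : seq A) (x : A) : Prop :=
  if s is y :: s' then exists a, in_ideal s' (x - a * y) else x = 0.

Section KoszulFiltration.
Variables (A : comNzRingType) (gr : nat -> A -> Prop) (Fam : seq A -> Prop).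

Hypothesis gr1_0 : gr 1 0.
Hypothesis gr1_opp : forall x, gr 1 x -> gr 1 (- x).
(** In a graded ring the degree 1 components of [a] serve as [a'], since [x *: r] has degree 2. This
    is what keeps the syzygies linear. *)
Hypothesis gr1_lift : forall p q (D : 'M[A]_(p, q)) (x : A) (r : 'rV_q) (a : 'rV_p),
  (forall i j, gr 1 (D i j)) -> gr 1 x -> (forall j, gr 1 (r 0 j)) ->
  x *: r = a *m D ->
  exists2 a' : 'rV_p, (forall j, gr 1 (a' 0 j)) & x *: r = a' *m D.
(** The defining property of a Koszul filtration: the ideal of [t] is the colon of the ideal of [s]
    by [x]. *)
Hypothesis Fam_cons : forall x s, Fam (x :: s) ->
  [/\ gr 1 x, Fam s &
      exists2 t, Fam t & forall f, in_ideal s (f * x) <-> in_ideal t f].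

Definition rowspan p q (D : 'M[A]_(p, q)) (v : 'rV_q) : Prop :=
  exists w, v = w *m D.

(** The analogue for modules: adjoining [r] to the row span of [D] adds a cyclic quotient isomorphic
    to [A] modulo the ideal of [t]. *)
Inductive filtered : forall p q, 'M[A]_(p, q) -> Prop :=
| filtered_nil q (D : 'M_(0, q)) : filtered D
| filtered_cons p q (r : 'rV_q) (D : 'M_(p, q)) t :
    (forall j, gr 1 (r 0 j)) -> filtered D -> Fam t ->
    (forall f, rowspan D (f *: r) <-> in_ideal t f) ->
    filtered (col_mx r D).

Lemma filtered_linear p q (D : 'M_(p, q)) :
  filtered D -> forall i j, gr 1 (D i j).
Proof.
elim=> {p q D} [q D []//|p q r D t gr_r _ IH _ _ i j].
by rewrite mxE; case: split => k; rewrite ?IH // ord1.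
Qed.

Lemma rowspan_col_mx p q (r : 'rV_q) (D : 'M[A]_(p, q)) v :
  rowspan (col_mx r D) v <-> exists f, rowspan D (v - f *: r).
Proof.
split=> [[w ->]|[f [w Dw]]].
  exists (w 0 0), (rsubmx w).
  rewrite -{1}[w]hsubmxK mul_row_col [lsubmx w]mx11_scalar mul_scalar_mx.
  by rewrite !mxE lshift0 addrC addKr.
exists (row_mx f%:M w).
by rewrite mul_row_col mul_scalar_mx -Dw addrC subrK.
Qed.

Lemma row_mx00 p (a : 'rV[A]_1) (b : 'rV_p) : row_mx a b 0 0 = a 0 0.
Proof. by rewrite mxE; case: splitP => // j _; rewrite ord1. Qed.

(** A zero column turns syzygies of a matrix into syzygies, with first coordinate 0, of the matrix
    with one more row on top. *)
Lemma filtered_row0 p q (D : 'M_(p, q)) :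
  filtered D -> filtered (row_mx (0 : 'cV_p) D).
Proof.
elim=> {p q D} [q D|p q r D t gr_r _ IH Ft tP]; first exact: filtered_nil.
rewrite -[0 : 'cV_(1 + p)]col_mx0 -block_mxEh block_mxEv.
apply: (filtered_cons (t := t)) => // [j|f].
  by rewrite mxE; case: split => k; rewrite // mxE.
rewrite -tP; split=> [[w]|[w Dw]].
  rewrite scale_row_mx mul_mx_row => /eq_row_mx[_ Dw].
  by exists w.
by exists w; rewrite scale_row_mx mul_mx_row -Dw mulmx0 scaler0.
Qed.

(** The elements of [s], stacked in a column, inherit the colon ideals of the family. Such a column
    will be the first differential. *)
Lemma filtered_column s : Fam s ->
  exists p (D : 'M_(p, 1)),
    filtered D /\ forall v, rowspan D v <-> in_ideal s (v 0 0).
Proof.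
elim: s => [_|x s IH /Fam_cons[gr_x /IH[p [D [fD DP]]] [t Ft tP]]].
  exists 0, 0; split=> [|v]; first exact: filtered_nil.
  split=> [[w ->]|v0]; first by rewrite mulmx0 mxE.
  by exists 0; rewrite mulmx0 [v]mx11_scalar v0 raddf0.
exists (1 + p), (col_mx x%:M D); split.
  apply: (filtered_cons (t := t)) => // [j|f]; first by rewrite ord1 mxE.
  by rewrite DP -tP !mxE.
move=> v; rewrite rowspan_col_mx /=.
by split=> -[f]; rewrite -?DP => Df; exists f; move: Df; rewrite ?DP !mxE.
Qed.

(* Schreyer's argument: if [f] times the first row [r] lies in the span of the
   rows of [D] exactly when [f] is in the ideal of [s], the syzygies
   [(x, - a)], with [x] in [s] and [x *: r = a *m D], again have linear
   colon ideals with respect to the earlier ones. *)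
Lemma filtered_syzygy_cons p q (r : 'rV_q) (D : 'M_(p, q)) p' (D' : 'M_(p', p)) s :
  (forall j, gr 1 (r 0 j)) -> filtered D -> filtered D' ->
  (forall v, v *m D = 0 <-> rowspan D' v) ->
  Fam s -> (forall f, in_ideal s f -> rowspan D (f *: r)) ->
  exists m (E : 'M_(m, 1 + p)), filtered E /\
    forall v, rowspan E v <-> v *m col_mx r D = 0 /\ in_ideal s (v 0 0).
Proof.
move=> gr_r fD fD' D'P; elim: s => [_ _|x s IH Fxs sr].
  exists p', (row_mx 0 D'); split; first exact: filtered_row0.
  move=> v; split=> [[w ->]|[]].
    rewrite mul_mx_row mulmx0 mul_row_col mul0mx add0r; split.
      by apply/D'P; exists w.
    by rewrite row_mx00 mxE.
  rewrite -[v]hsubmxK mul_row_col row_mx00.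
  move=> + v0; rewrite [lsubmx v]mx11_scalar v0 raddf0.
  rewrite mul0mx add0r => /D'P[w Dw].
  by exists w; rewrite mul_mx_row mulmx0 -Dw.
have [gr_x Fs [t Ft tP]] := Fam_cons Fxs.
have [|m [E [fE EP]]] := IH Fs.
  by move=> f sf; apply: sr => /=; exists 0; rewrite mul0r subr0.
have [a Da] : rowspan D (x *: r).
  apply: sr => /=; exists 1; rewrite mul1r subrr.
  by elim: (s) => //= y s' s0; exists 0; rewrite mul0r subr0.
(* Linear coefficients replace [a], so that the new syzygy [e] has entries of degree 1. *)
have [a' gr_a' {}Da] := gr1_lift (filtered_linear fD) gr_x gr_r Da.
pose e : 'rV_(1 + p) := row_mx x%:M (- a').
have De : e *m col_mx r D = 0.
  by rewrite mul_row_col mul_scalar_mx Da mulNmx subrr.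
have e0 : e 0 0 = x by rewrite row_mx00 mxE.
have fe f : (f *: e) 0 0 = f * x by rewrite -e0 mxE.
(* Since [f *: e] is always a syzygy and has first coordinate [f * x], the colon ideal of [e] is
   that of [x] with respect to [s], namely [t]. *)
exists (1 + m), (col_mx e E); split.
  apply: (filtered_cons (t := t)) => // [j|f].
    rewrite mxE; case: split => k; rewrite !mxE ?ord1 //.
    exact: gr1_opp.
  rewrite EP -tP -scalemxAl De scaler0 fe.
  by split=> [[]|].
have vE v f : (v - f *: e) 0 0 = v 0 0 - f * x by rewrite -(fe f) !mxE.
move=> v; rewrite rowspan_col_mx; split=> [[f]|[vD [f fP]]].
  rewrite EP mulmxBl -scalemxAl De scaler0 subr0 => -[vD sf]; split=> //.
  by exists f; rewrite -vE.
exists f; rewrite EP mulmxBl -scalemxAl De scaler0 subr0; split=> //.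
by rewrite vE.
Qed.

(** Induction on the rows. The first coordinate of a syzygy lies in the colon ideal [t]
    automatically, as the other coordinates write its multiple of [r] in terms of [D]. *)
Lemma filtered_syzygy p q (D : 'M_(p, q)) : filtered D ->
  exists p' (D' : 'M_(p', p)),
    filtered D' /\ forall v, v *m D = 0 <-> rowspan D' v.
Proof.
elim=> {p q D} [q D|p q r D t gr_r fD [p' [D' [fD' D'P]]] Ft tP].
  exists 0, 0; split=> [|v]; first exact: filtered_nil.
  by split=> _; [exists 0; rewrite !thinmx0 | rewrite [v]thinmx0 mul0mx].
have [f /tP //|m [E [fE EP]]] := filtered_syzygy_cons gr_r fD fD' D'P Ft.
exists m, E; split=> // v; rewrite EP; split=> [vD|[]//]; split=> //.
apply/tP; exists (- rsubmx v); apply/eqP.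
rewrite mulNmx -addr_eq0 -vD -{3}[v]hsubmxK mul_row_col.
by rewrite [lsubmx v]mx11_scalar mul_scalar_mx !mxE lshift0.
Qed.

(** The sizes change along the resolution; bundling them with the matrix makes the passage to
    syzygies iterable. *)
Record stage := Stage {
  st_rank : nat;
  st_next : nat;
  st_mx : 'M[A]_(st_next, st_rank);
  st_filtered : filtered st_mx }.

(** The resolution starts with the column of generators of the maximal ideal and continues with
    filtered, hence linear, syzygy matrices. *)
Lemma koszul_of_filtration s :
  Fam s -> (forall x, irrelevant_ideal gr x <-> in_ideal s x) -> koszul gr.
Proof.
move=> Fs sP; have [p [D [fD DP]]] := filtered_column Fs.
pose nextP (S : stage) := filtered_syzygy (st_filtered S).
pose succ (S : stage) :=
  Stage (proj1 (projT2 (cid (projT2 (cid (nextP S)))))).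
pose st n := iter n succ (Stage fD).
exists (fun n => st_rank (st n)), (fun n => st_mx (st n)); split=> //.
- by move=> i r c; apply: filtered_linear; exact: st_filtered.
- move=> v; rewrite [X in _ <-> X]/= -/(rowspan D v) DP -sP.
  by split=> [|v0 c]; [exact | rewrite (ord1 c)].
move=> i v; exact: (proj2 (projT2 (cid (projT2 (cid (nextP (st i))))))).
Qed.

End KoszulFiltration.

(** * Ideals generated by linear forms *)

Section LinearIdeals.
Variables (K : fieldType) (n : nat).
Local Notation S := {mpoly K[n.+1]}.
Implicit Types (f g : S) (u v : 'rV[K]_n.+1).

Definition is_ideal (Q : S -> Prop) : Prop :=
  Q 0 /\ forall a p q, Q p -> Q q -> Q (a * p + q).

Definition lin_ideal r (C : 'M[K]_(r, n.+1)) : S -> Prop :=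
  generated_ideal (fun f => exists j, f = linear_form (row j C)).

Section IdealTheory.
Variables (Q : S -> Prop) (idQ : is_ideal Q).

Lemma ideal0 : Q 0. Proof. exact: idQ.1. Qed.

Lemma idealD f g : Q f -> Q g -> Q (f + g).
Proof. by move=> Qf Qg; rewrite -[f]mul1r; exact: idQ.2. Qed.

Lemma ideal_mull a f : Q f -> Q (a * f).
Proof. by move=> Qf; rewrite -[_ * _]addr0; apply: idQ.2 => //; exact: ideal0. Qed.

Lemma ideal_mulr a f : Q f -> Q (f * a).
Proof. by rewrite mulrC; exact: ideal_mull. Qed.

Lemma idealB f g : Q f -> Q g -> Q (f - g).
Proof. by move=> Qf Qg; apply: idealD => //; rewrite -mulN1r; exact: ideal_mull. Qed.

Lemma idealZ c f : Q f -> Q (c *: f).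
Proof. by rewrite -mul_mpolyC; exact: ideal_mull. Qed.

Lemma ideal_sum I (r : seq I) (P : pred I) (F : I -> S) :
  (forall i, P i -> Q (F i)) -> Q (\sum_(i <- r | P i) F i).
Proof. by move=> QF; apply: big_ind => //; [exact: ideal0 | exact: idealD]. Qed.

Lemma generated_ideal_sub (G : S -> Prop) f :
  (forall g, G g -> Q g) -> generated_ideal G f -> Q f.
Proof.
move=> GQ [r [a [g [Gg ->]]]].
by apply: ideal_sum => j _; apply/ideal_mull/GQ/Gg.
Qed.

End IdealTheory.

Lemma generated_idealP (G : S -> Prop) : is_ideal (generated_ideal G).
Proof.
split; first exact: generated_ideal0.
by move=> a p q; exact: generated_ideal_linear.
Qed.

Lemma generated_ideal_mem (G : S -> Prop) f : G f -> generated_ideal G f.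
Proof.
move=> Gf; exists 1, (fun=> 1), (fun=> f); split=> //.
by rewrite big_ord1 mul1r.
Qed.

Lemma lin_idealP r (C : 'M[K]_(r, n.+1)) : is_ideal (lin_ideal C).
Proof. exact: generated_idealP. Qed.

Lemma linear_form_is_linear : linear (@linear_form K n).
Proof.
move=> a u v; rewrite /linear_form scaler_sumr -big_split /=.
by apply: eq_bigr => k _; rewrite !mxE scalerDl scalerA.
Qed.

HB.instance Definition _ :=
  GRing.isLinear.Build K 'rV[K]_n.+1 S *:%R (@linear_form K n)
    linear_form_is_linear.

Lemma linear_form_delta k : linear_form (delta_mx 0 k) = 'X_k :> S.
Proof.
rewrite /linear_form (bigD1 k) //= mxE !eqxx scale1r big1 ?addr0 // => i ik.
by rewrite mxE (negPf ik) andbF scale0r.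
Qed.

Lemma linear_form_eq0 u : (linear_form u == 0) = (u == 0).
Proof.
apply/eqP/eqP => [u0|->]; last exact: raddf0.
apply/rowP => k; move: (congr1 (mcoeff U_(k)) u0).
rewrite mcoeff0 mxE raddf_sum (bigD1 k) //= mcoeffZ mcoeffX eqxx mulr1.
rewrite big1 ?addr0 // => i ik.
by rewrite mcoeffZ mcoeffX eq_mnm1 (negPf ik) mulr0.
Qed.

Lemma linear_form_homog u : linear_form u \is 1.-homog.
Proof.
apply: rpred_sum => k _; apply: rpredZ.
by rewrite dhomogX /= mdeg1.
Qed.

Lemma linear_form_mulmx r (w : 'rV[K]_r) (C : 'M[K]_(r, n.+1)) :
  linear_form (w *m C) = \sum_j w 0 j *: linear_form (row j C).
Proof.
by rewrite mulmx_sum_row raddf_sum; apply: eq_bigr => j _; rewrite /= linearZ.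
Qed.

Lemma lin_ideal_mem r (C : 'M[K]_(r, n.+1)) u :
  (u <= C)%MS -> lin_ideal C (linear_form u).
Proof.
case/submxP=> w ->; rewrite linear_form_mulmx.
apply: (ideal_sum (lin_idealP C)) => j _; apply: (idealZ (lin_idealP C)).
by apply: generated_ideal_mem; exists j.
Qed.

Lemma lin_ideal_sub r (C : 'M[K]_(r, n.+1)) Q f : is_ideal Q ->
  (forall u, (u <= C)%MS -> Q (linear_form u)) -> lin_ideal C f -> Q f.
Proof.
move=> idQ CQ; apply: (generated_ideal_sub idQ) => g [j ->].
by apply: CQ; exact: row_sub.
Qed.

(** * Linear substitutions and cancellation modulo linear forms *)

Definition lin_subst (E : 'M[K]_n.+1) (f : S) : S :=
  f \mPo [tuple linear_form (row k E) | k < n.+1].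

Lemma lin_subst_linear_form E u :
  lin_subst E (linear_form u) = linear_form (u *m E).
Proof.
rewrite /lin_subst linear_form_mulmx raddf_sum.
by apply: eq_bigr => k _; rewrite /= comp_mpolyZ comp_mpolyXU -tnth_nth tnth_mktuple.
Qed.

(** The polynomials unchanged modulo the ideal are closed under sums, products and scalars, and
    contain the variables. *)
Lemma lin_subst_sub r (C : 'M[K]_(r, n.+1)) E f :
  (forall u, (u - u *m E <= C)%MS) -> lin_ideal C (f - lin_subst E f).
Proof.
move=> EC; have idC := lin_idealP C.
pose Q g := lin_ideal C (g - lin_subst E g).
have QM g h : Q g -> Q h -> Q (g * h).
  move=> Qg Qh; rewrite /Q /lin_subst rmorphM /=.
  have -> (a b c d : S) : a * b - c * d = a * (b - d) + d * (a - c) by ring.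
  by apply: (idealD idC); apply: (ideal_mull idC).
have Q1 : Q 1 by rewrite /Q /lin_subst rmorph1 subrr; exact: ideal0.
rewrite -/(Q f) [f]mpolyE; apply: big_ind => [|g h Qg Qh|m _].
- by rewrite /Q /lin_subst raddf0 subrr; exact: ideal0.
- by rewrite /Q /lin_subst raddfD opprD addrACA; exact: (idealD idC).
have QX : Q 'X_[m].
  rewrite mpolyXE_id; apply: big_ind => [||k _]; [exact: Q1 | exact: QM |].
  elim: (m k) => [|d IH]; rewrite (expr0, exprS); [exact: Q1 | apply: QM; last exact: IH].
  rewrite /Q -linear_form_delta lin_subst_linear_form -raddfB.
  exact: lin_ideal_mem.
by rewrite /Q /lin_subst linearZ -scalerBr; exact: (idealZ idC).
Qed.

(** Substituting along the projection [E] onto a complement of [C] kills the ideal and preserves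
    classes modulo it, so the quotient embeds in a polynomial ring, which is a domain. *)
Lemma lin_ideal_prime r (C : 'M[K]_(r, n.+1)) f u :
  ~~ (u <= C)%MS -> lin_ideal C (f * linear_form u) -> lin_ideal C f.
Proof.
move=> uC Cfu; pose E := proj_mx C^C%MS <<C>>%MS.
have capE : (C^C :&: <<C>> = 0)%MS.
  by apply/eqP; rewrite -submx0 (cap_eqmx (eqmx_refl _) (genmxE C)) capmxC capmx_compl.
have EC v : (v - v *m E <= C)%MS.
  rewrite -{1}(add_proj_mx capE (_ : v <= _)%MS); last first.
    rewrite addsmxC (adds_eqmx (genmxE C) (eqmx_refl _)).
    exact/submx_full/addsmx_compl_full.
  rewrite addrC addKr -(genmxE C); exact: proj_mx_sub.
have E0 v : (v <= C)%MS -> v *m E = 0.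
  by move=> vC; apply: proj_mx_0 capE _; rewrite genmxE.
have C0 g : lin_ideal C g -> lin_subst E g = 0.
  apply: (lin_ideal_sub (Q := fun g => lin_subst E g = 0)) => [|v vC].
    split=> [|a p q p0 q0]; first exact: raddf0.
    by rewrite /lin_subst rmorphD rmorphM /= [p \mPo _]p0 [q \mPo _]q0 mulr0 addr0.
  by rewrite /= lin_subst_linear_form E0 ?raddf0.
have := lin_subst_sub f EC; have /eqP := C0 _ Cfu.
rewrite {1}/lin_subst rmorphM mulf_eq0 /= -!/(lin_subst _ _).
rewrite lin_subst_linear_form linear_form_eq0 => /orP[/eqP-> | ].
  by rewrite subr0.
by move=> /eqP uE; move: (EC u); rewrite uE subr0 (negPf uC).
Qed.

(** * Homogeneous components in ideals of linear forms *)

Lemma pihomogM_lin d f g : g \is 1.-homog ->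
  pihomog mdeg d (f * g) =
  if d is d'.+1 then pihomog mdeg d' f * g else 0.
Proof.
move=> hg; rewrite {1}(pihomog_partitionE (leqnn (msize f))) mulr_suml raddf_sum /=.
have hom e : pihomog mdeg e f * g \is e.+1.-homog.
  by rewrite -[e.+1]addn1; apply: dhomogM (pihomogP _ _ _) hg.
case: d => [|d]; first by apply: big1 => e _; exact: pihomog_ne0 (hom e).
have [df|fd] := ltnP d (msize f).
  rewrite (bigD1 (Ordinal df)) //= pihomog_dE // big1 ?addr0 // => e ed.
  by apply: pihomog_ne0 (hom e).
rewrite big1 => [|e _]; last first.
  by apply: pihomog_ne0 (hom e); rewrite eqSS neq_ltn (leq_trans (ltn_ord e)).
rewrite [pihomog _ _ f]pihomogE big_seq_cond big1 ?mul0r // => m /andP[mf /eqP dm].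
by move: fd; rewrite -dm leqNgt msize_mdeg_lt.
Qed.

Lemma lin_ideal_pihomog r (C : 'M[K]_(r, n.+1)) d f :
  lin_ideal C f -> lin_ideal C (pihomog mdeg d f).
Proof.
move=> [s [a [g [Gg ->]]]]; rewrite raddf_sum.
apply: (ideal_sum (lin_idealP C)) => j _; have [k ->] := Gg j.
rewrite /= pihomogM_lin ?linear_form_homog //.
case: d => [|d]; first exact: (ideal0 (lin_idealP C)).
by apply/(ideal_mull (lin_idealP C))/lin_ideal_mem/row_sub.
Qed.

Lemma lin_ideal_pihomog0 r (C : 'M[K]_(r, n.+1)) f :
  lin_ideal C f -> pihomog mdeg 0 f = 0.
Proof.
move=> [s [a [g [Gg ->]]]]; rewrite raddf_sum big1 // => j _.
by have [k ->] := Gg j; rewrite /= pihomogM_lin ?linear_form_homog.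
Qed.

Lemma lin_ideal1_homog d f : f \is d.+1.-homog -> lin_ideal 1%:M f.
Proof.
move=> /dhomogP hf; have id1 := lin_idealP (1%:M : 'M[K]_n.+1).
rewrite [f]mpolyE big_seq; apply: (ideal_sum id1) => m /hf /= dm.
apply: (idealZ id1).
have [k mk] : exists k, m k != 0%N.
  apply/existsP; apply: contraTT isT; rewrite negb_exists => /forallP m0.
  by move: dm; rewrite mdegE big1 // => k _; apply/eqP; move: (m0 k); rewrite negbK.
have -> : m = (m - U_(k) + U_(k))%MM by rewrite submK // lep1mP.
rewrite mpolyXD -linear_form_delta; apply/(ideal_mull id1)/lin_ideal_mem.
exact: submx1.
Qed.

End LinearIdeals.

(** * Five lines in general position *)

Ltac split_distinct d :=
  let H := fresh in have H := d; rewrite /= !inE !negb_or -!andbA in H; move: H;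
  repeat match goal with
  | |- is_true (_ && _) -> _ => case/andP; let H := fresh "neq" in intro H
  end;
  let H := fresh "neq" in intro H.

Ltac distinct :=
  rewrite /= ?inE ?negb_or -?andbA; repeat (apply/andP; split);
  solve [done | assumption | rewrite eq_sym; assumption].

Lemma distinct_cover (i j k l m x : 'I_5) :
  uniq [:: i; j; k; l; m] -> x \in [:: i; j; k; l; m].
Proof.
move=> /card_uniqP/= card5.
have eq5 : #|[:: i; j; k; l; m]| = #|'I_5| by rewrite card5 card_ord.
by rewrite (subset_cardP eq5 (subset_predT _)).
Qed.

Section Configuration.
Variables (K : fieldType) (c : 'I_5 -> 'M[K]_(5, 7)).
Local Notation S := {mpoly K[7]}.
Implicit Types (f g h : S) (u : 'rV[K]_7) (s : seq S).

Hypothesis c_free : forall i, row_free (c i).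
(** Here [u] vanishes on the lines [k], [l], [m] and [v] on [j], [l], [m], as do e_ij and e_ik: this
    is their independence modulo L_i, stated before they are chosen. *)
Hypothesis c_generic : forall i j k l m, uniq [:: i; j; k; l; m] ->
  forall u v : 'rV_7,
    (u <= c k)%MS -> (u <= c l)%MS -> (u <= c m)%MS ->
    (v <= c j)%MS -> (v <= c l)%MS -> (v <= c m)%MS ->
    ((u + v)%R <= c i)%MS -> u = 0 /\ v = 0.

(* The hyperplane through the three lines other than [i] and [j]. *)
Definition hyp i j : 'rV[K]_7 :=
  nz_row (\bigcap_(k | (k != i) && (k != j)) <<c k>>)%MS.

Lemma hypC i j : hyp i j = hyp j i.
Proof. by congr nz_row; apply: eq_bigl => k; rewrite andbC. Qed.

Lemma hyp_sub i j k : k != i -> k != j -> (hyp i j <= c k)%MS.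
Proof.
move=> ki kj; rewrite -(genmxE (c k)); apply: submx_trans (nz_row_sub _) _.
by rewrite (bigcapmx_inf k) ?ki.
Qed.

(** Three subspaces of dimension 5 in a space of dimension 7 have a nonzero intersection. *)
Lemma hyp_neq0 i j k l m : uniq [:: i; j; k; l; m] -> hyp i j != 0.
Proof.
move=> d; split_distinct d; rewrite nz_row_eq0.
have [u u0 uklm] : exists2 u : 'rV[K]_7, u != 0 & (u <= c k :&: c l :&: c m)%MS.
  exists (nz_row (c k :&: c l :&: c m)%MS); last exact: nz_row_sub.
  rewrite nz_row_eq0 -mxrank_eq0 -lt0n.
  have rk x : \rank (c x) = 5 by exact/eqP/c_free.
  have := mxrank_sum_cap (c k) (c l); have := mxrank_sum_cap (c k :&: c l)%MS (c m).
  have := rank_leq_col (c k + c l)%MS; have := rank_leq_col ((c k :&: c l) + c m)%MS.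
  rewrite !rk; do 4! move: (\rank _); clear. lia.
apply: contraNneq u0 => cap0; rewrite -submx0 -cap0.
apply/sub_bigcapmxP => x /andP[xi xj]; rewrite genmxE.
move: uklm; rewrite !sub_capmx -andbA => /and3P[uk ul um].
by have := distinct_cover x d; rewrite !inE (negPf xi) (negPf xj) /= => /or3P[]/eqP->.
Qed.

Lemma hyp_free i j k l m a b : uniq [:: i; j; k; l; m] ->
  ((a *: hyp i j + b *: hyp i k)%R <= c i)%MS -> a = 0 /\ b = 0.
Proof.
move=> d abc; have dk : uniq [:: i; k; j; l; m] by split_distinct d; distinct.
have /eqP hij := hyp_neq0 d; have /eqP hik := hyp_neq0 dk.
split_distinct d.
have [|||||||a0 b0] := c_generic (u := a *: hyp i j) (v := b *: hyp i k) d.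
1-6: by apply/scalemx_sub/hyp_sub; distinct.
  exact: abc.
move/eqP: a0; move/eqP: b0; rewrite !scaler_eq0.
by move=> /orP[/eqP-> | /eqP//] /orP[/eqP-> | /eqP//].
Qed.

Lemma hyp_nsub i j k l m : uniq [:: i; j; k; l; m] -> ~~ (hyp i j <= c i)%MS.
Proof.
move=> d; apply/negP => hc; have [] := @hyp_free _ _ _ _ _ 1 0 d.
  by rewrite scale1r scale0r addr0.
by move/eqP; rewrite oner_eq0.
Qed.

(** The two independent forms and the 5-dimensional space [c i] meet trivially, and 2 + 5 = 7. *)
Lemma hyp_span i j k l m u : uniq [:: i; j; k; l; m] ->
  exists a b, (u - a *: hyp i j - b *: hyp i k <= c i)%MS.
Proof.
move=> d; pose M := col_mx (hyp i j) (hyp i k).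
have capM : (M :&: c i = 0)%MS.
  apply/eqP/rowV0P => v; rewrite sub_capmx => /andP[/submxP[w ->]].
  rewrite -[w]hsubmxK mul_row_col [lsubmx w]mx11_scalar [rsubmx w]mx11_scalar.
  by rewrite !mul_scalar_mx => /(hyp_free d)[-> ->]; rewrite !scale0r addr0.
have rkM : \rank M = 2.
  apply/eqP/inj_row_free => v; rewrite -[v]hsubmxK mul_row_col.
  rewrite [lsubmx v]mx11_scalar [rsubmx v]mx11_scalar !mul_scalar_mx => v0.
  have [|-> ->] := hyp_free (a := lsubmx v 0 0) (b := rsubmx v 0 0) d.
    by rewrite v0 sub0mx.
  by rewrite !raddf0 row_mx0.
have full : (1%:M <= M + c i)%MS.
  rewrite sub1mx /row_full; have := mxrank_sum_cap M (c i).
  by rewrite capM mxrank0 addn0 => ->; rewrite rkM (eqP (c_free i)).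
have /sub_addsmxP[[w w'] /= uE] := submx_trans (submx1 u) full.
exists (lsubmx w 0 0), (rsubmx w 0 0).
rewrite -addrA -opprD -!mul_scalar_mx -!mx11_scalar -mul_row_col hsubmxK uE.
by rewrite addrC addKr submxMl.
Qed.

(** Modulo [c l], [u] is a combination of [hyp l m] and [hyp l i]; genericity at [l] then forces
    [u - a *: hyp l m] to vanish. *)
Lemma hyp_uniq i j k l m u : uniq [:: i; j; k; l; m] ->
  (u <= c i)%MS -> (u <= c j)%MS -> (u <= c k)%MS -> exists a, u = a *: hyp l m.
Proof.
move=> d ui uj uk.
have dl : uniq [:: l; m; i; j; k] by split_distinct d; distinct.
have [a [b ab]] := hyp_span u dl; exists a; split_distinct d.
have sub x : (u <= c x)%MS -> x != l -> x != m -> (u - a *: hyp l m <= c x)%MS.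
  by move=> ux xl xm; rewrite addmx_sub // eqmx_opp scalemx_sub ?hyp_sub.
have [|||||||/eqP + _] := c_generic (i := l) (j := m) (k := i) (l := j) (m := k)
    (u := u - a *: hyp l m) (v := - b *: hyp l i) dl.
1-3: by apply: sub => //; distinct.
1-3: by apply/scalemx_sub/hyp_sub; distinct.
  by rewrite scaleNr.
by rewrite subr_eq0 => /eqP.
Qed.

(** * Edges [E i j] of the complete graph on the five lines, and the ideals they generate *)

Local Notation L i := (lin_ideal (c i)).
Local Notation P i j := (lin_ideal (col_mx (c i) (hyp i j))).
Local Notation E i j := (linear_form (hyp i j)).
Local Notation T k l m := [:: E l m; E k m; E k l].

Definition lines_ideal f : Prop := forall i, L i f.

(** The preimage in S of an ideal of S / J, built in parallel with [in_ideal], so that computations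
    take place among polynomials. *)
Fixpoint rel_ideal s f : Prop :=
  if s is y :: s' then exists a, rel_ideal s' (f - a * y) else lines_ideal f.

Lemma lines_idealP : is_ideal lines_ideal.
Proof.
split=> [i|a p q Jp Jq i]; first exact: ideal0 (lin_idealP _).
exact: (lin_idealP _).2.
Qed.

Lemma rel_idealP s : is_ideal (rel_ideal s).
Proof.
elim: s => [|y s IH]; first exact: lines_idealP.
split=> [|a p q [g pg] [h qh]].
  by exists 0; rewrite mul0r subr0; exact: ideal0.
exists (a * g + h).
have -> : a * p + q - (a * g + h) * y = a * (p - g * y) + (q - h * y) by ring.
exact: IH.2.
Qed.

Lemma rel_ideal_cons y s f : rel_ideal s f -> rel_ideal (y :: s) f.
Proof. by move=> sf; exists 0; rewrite mul0r subr0. Qed.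

Lemma rel_ideal0 s f : lines_ideal f -> rel_ideal s f.
Proof. by move=> Jf; elim: s => // y s IH; exact: rel_ideal_cons. Qed.

Lemma rel_ideal_mem s y : y \in s -> rel_ideal s y.
Proof.
elim: s => // x s IH; rewrite inE => /orP[/eqP->|/IH/rel_ideal_cons//].
by exists 1; rewrite mul1r subrr; exact: ideal0 (rel_idealP s).
Qed.

Lemma rel_ideal_sub Q s f : is_ideal Q -> (forall f, lines_ideal f -> Q f) ->
  (forall y, y \in s -> Q y) -> rel_ideal s f -> Q f.
Proof.
move=> idQ JQ; elim: s f => [|y s IH] f sQ; first exact: JQ.
case=> a sf; rewrite -(subrK (a * y) f); apply: (idealD idQ).
  by apply: IH sf => z zs; apply: sQ; rewrite inE zs orbT.
by apply/(ideal_mull idQ)/sQ; rewrite inE eqxx.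
Qed.

Lemma rel_ideal_subset s t f :
  {subset s <= t} -> rel_ideal s f -> rel_ideal t f.
Proof.
move=> st; apply: (rel_ideal_sub (rel_idealP t)) => [g|y /st].
  exact: rel_ideal0.
exact: rel_ideal_mem.
Qed.

Lemma EC i j : E i j = E j i. Proof. by rewrite hypC. Qed.

Lemma L_E k i j : k != i -> k != j -> L k (E i j).
Proof. by move=> ki kj; apply/lin_ideal_mem/hyp_sub. Qed.

Lemma L_prime i j k l m f : uniq [:: i; j; k; l; m] ->
  L i (f * E i j) -> L i f.
Proof. by move=> d; apply: lin_ideal_prime; exact: hyp_nsub d. Qed.

Lemma P_mem i j u : reflect (exists a, u - a *: hyp i j <= c i)%MS
  (u <= col_mx (c i) (hyp i j))%MS.
Proof.
rewrite -addsmxE; apply: (iffP sub_addsmxP) => [[[w w2] /= ->]|[a /submxP[w uw]]].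
  rewrite [w2]mx11_scalar mul_scalar_mx; exists (w2 0 0).
  by rewrite addrK submxMl.
by exists (w, a%:M); rewrite /= mul_scalar_mx -uw subrK.
Qed.

Lemma P_prime i j k l m f : uniq [:: i; j; k; l; m] ->
  P i k (f * E i j) -> P i k f.
Proof.
move=> d; apply: lin_ideal_prime; apply/P_mem => -[a ua].
have [] := @hyp_free _ _ _ _ _ 1 (- a) d; first by rewrite scale1r scaleNr.
by move/eqP; rewrite oner_eq0.
Qed.

Lemma L_P i j f : L i f -> P i j f.
Proof.
apply: lin_ideal_sub (lin_idealP _) _ => u ui; apply/lin_ideal_mem/P_mem.
by exists 0; rewrite scale0r subr0.
Qed.

Lemma P_E i j : P i j (E i j).
Proof.
by apply/lin_ideal_mem/P_mem; exists 1; rewrite scale1r subrr sub0mx.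
Qed.

Lemma P_decomp i j f : P i j f -> exists g, L i (f - g * E i j).
Proof.
apply: (lin_ideal_sub (Q := fun f => exists g, L i (f - g * E i j))).
  split=> [|a p q [g pg] [h qh]].
    by exists 0; rewrite mul0r subr0; exact: ideal0 (lin_idealP _).
  exists (a * g + h).
  have -> (e : S) : a * p + q - (a * g + h) * e = a * (p - g * e) + (q - h * e) by ring.
  exact: (lin_idealP _).2.
move=> u /P_mem[a ua]; exists a%:MP.
by rewrite mul_mpolyC -linearZ -raddfB; exact: lin_ideal_mem.
Qed.

Lemma lines_idealE i j k l m f : uniq [:: i; j; k; l; m] ->
  L i f -> L j f -> L k f -> L l f -> L m f -> lines_ideal f.
Proof.
move=> d Li Lj Lk Ll Lm x; have := distinct_cover x d.
by rewrite !inE => /or4P[|||/orP[]] /eqP->.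
Qed.

(** No line is an endpoint of both of two disjoint edges, so on each line one factor vanishes. *)
Lemma E_mul0 i j k l m : uniq [:: i; j; k; l; m] ->
  lines_ideal (E i k * E j l).
Proof.
move=> d; split_distinct d.
apply: (lines_idealE d);
  first [by apply: (ideal_mull (lin_idealP _)); apply: L_E; distinct
        |by apply: (ideal_mulr (lin_idealP _)); apply: L_E; distinct].
Qed.

Lemma T_rotate k l m f : rel_ideal (T k l m) f -> rel_ideal (T l m k) f.
Proof.
apply: rel_ideal_subset => y; rewrite !inE [E m k]EC [E l k]EC.
by case/or3P=> ->; rewrite ?orbT.
Qed.

Lemma T_swap k l m f : rel_ideal (T k l m) f -> rel_ideal (T l k m) f.
Proof.
apply: rel_ideal_subset => y; rewrite !inE [E l k]EC.
by case/or3P=> ->; rewrite ?orbT.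
Qed.

(** Subtracting multiples of the two edges at [k] makes the form vanish on line [k] too; by
    [hyp_uniq] the rest is a multiple of the third edge. *)
Lemma T_linear_form i j k l m u : uniq [:: i; j; k; l; m] ->
  (u <= c i)%MS -> (u <= c j)%MS -> rel_ideal (T k l m) (linear_form u).
Proof.
move=> d ui uj.
have dk : uniq [:: k; l; m; i; j] by split_distinct d; distinct.
have [a [b uab]] := hyp_span u dk; split_distinct d.
have [||a' ea'] := hyp_uniq (u := u - a *: hyp k l - b *: hyp k m) d _ _ uab.
- by rewrite !addmx_sub ?eqmx_opp ?scalemx_sub ?hyp_sub //; distinct.
- by rewrite !addmx_sub ?eqmx_opp ?scalemx_sub ?hyp_sub //; distinct.
exists a'%:MP, b%:MP, a%:MP.
rewrite !mul_mpolyC -!linearZ -!raddfB /= -ea'.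
have -> (x y z : 'rV[K]_7) : x - (x - y - z) - z - y = 0.
  by rewrite -[x - y - z]addrA -opprD subKr addrK subrr.
by rewrite raddf0; exact: ideal0 lines_idealP.
Qed.

(** It suffices to treat linear forms: two edges at [j] correct such a form to one that also
    vanishes on line [j], covered by [T_linear_form]. *)
Lemma L_decomp i j k l m f : uniq [:: i; j; k; l; m] -> L i f ->
  exists g h, rel_ideal (T k l m) (f - g * E j l - h * E j m).
Proof.
move=> d; have idT := rel_idealP (T k l m).
apply: (lin_ideal_sub
  (Q := fun f => exists g h, rel_ideal (T k l m) (f - g * E j l - h * E j m))).
  split=> [|a p q [g [h pgh]] [g' [h' qgh]]].
    by exists 0, 0; rewrite !mul0r !subr0; exact: ideal0.
  exists (a * g + g'), (a * h + h').
  have -> (e e' : S) : a * p + q - (a * g + g') * e - (a * h + h') * e' =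
    a * (p - g * e - h * e') + (q - g' * e - h' * e') by ring.
  exact: idT.2.
have dj : uniq [:: j; l; m; i; k] by split_distinct d; distinct.
move=> u ui; have [a [b uab]] := hyp_span u dj.
exists a%:MP, b%:MP; rewrite !mul_mpolyC -!linearZ -!raddfB.
apply: (T_linear_form d) uab; split_distinct d.
by rewrite !addmx_sub ?eqmx_opp ?scalemx_sub ?hyp_sub //; distinct.
Qed.

(** [L_decomp] writes [f] by the triangle and the edges [E i k] and [E i m], both disjoint from
    [E j l]. *)
Lemma T_mul i j k l m f : uniq [:: i; j; k; l; m] ->
  L j f -> rel_ideal (T k l m) (f * E j l).
Proof.
move=> d; have d' : uniq [:: j; i; l; k; m] by split_distinct d; distinct.
case/(L_decomp d') => g [h fgh]; have idT := rel_idealP (T k l m).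
have -> : f * E j l = (f - g * E i k - h * E i m) * E j l +
    g * (E i k * E j l) + h * (E i m * E j l) by ring.
apply: (idealD idT); first apply: (idealD idT).
- exact/(ideal_mulr idT)/T_swap.
- exact/(ideal_mull idT)/rel_ideal0/(E_mul0 d).
- apply/(ideal_mull idT)/rel_ideal0/(@E_mul0 _ _ _ _ k).
  by split_distinct d; distinct.
Qed.

(* The triangle on [k], [l], [m] generates the ideal of the two other lines.
   Modulo the triangle an element of [L i] is [g * E j l + h * E j m]; if it
   also lies in [L j], then [(g, h)] is a Koszul syzygy of [E j l] and [E j m]
   modulo [L j], and [L j] multiplies both of them into the triangle ideal. *)
Lemma triangle_ideal i j k l m f : uniq [:: i; j; k; l; m] ->
  rel_ideal (T k l m) f <-> L i f /\ L j f.
Proof.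
move=> d; have idT := rel_idealP (T k l m).
have TL x g : x != k -> x != l -> x != m -> rel_ideal (T k l m) g -> L x g.
  move=> xk xl xm; apply: (rel_ideal_sub (lin_idealP (c x))) => [g' /(_ x)//|y].
  by rewrite !inE => /or3P[]/eqP->; exact: L_E.
split=> [Tf|[]]; first by split_distinct d; split; apply: (TL _ _ _ _ _ Tf); distinct.
case/(L_decomp d) => g [h fgh] Lf.
have {}Lf : L j (g * E j l + h * E j m).
  have -> : g * E j l + h * E j m = f - (f - g * E j l - h * E j m) by ring.
  apply: (idealB (lin_idealP _)) => //.
  by split_distinct d; apply: TL fgh; distinct.
have [h' Lh] : exists h', L j (h - h' * E j l).
  apply: P_decomp; apply: (@P_prime j m l i k); first by split_distinct d; distinct.
  rewrite -[h * _](addKr (g * E j l)) addrC.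
  apply: (idealB (lin_idealP _)); first exact: L_P.
  exact/(ideal_mull (lin_idealP _))/P_E.
have Lg : L j (g + h' * E j m).
  apply: (@L_prime j l k i m); first by split_distinct d; distinct.
  have -> : (g + h' * E j m) * E j l =
    g * E j l + h * E j m - (h - h' * E j l) * E j m by ring.
  by apply: (idealB (lin_idealP _)) => //; exact: (ideal_mulr (lin_idealP _)).
have -> : f = (f - g * E j l - h * E j m) +
    ((g + h' * E j m) * E j l + (h - h' * E j l) * E j m) by ring.
apply: (idealD idT) => //; apply: (idealD idT); first exact: (T_mul d).
apply/T_rotate/T_swap/(@T_mul i) => //.
by split_distinct d; distinct.
Qed.

(** * Members of the filtration as intersections of primes, and their colon ideals *)

Local Notation Quad j k l m := [:: E j l, E j m & T k l m].

Ltac E_in_ideal :=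
  solve [exact: P_E | apply: L_E; distinct | apply: L_P; apply: L_E; distinct].

Lemma colon_idealP s y : is_ideal (fun f => rel_ideal s (f * y)).
Proof.
have ids := rel_idealP s; split=> [|a p q sp sq]; first by rewrite mul0r; exact: ideal0.
by rewrite mulrDl -mulrA; exact: ids.2.
Qed.

Lemma rel_ideal_L x s f :
  (forall y, y \in s -> L x y) -> rel_ideal s f -> L x f.
Proof. by apply: (rel_ideal_sub (lin_idealP _)) => g; exact. Qed.

Lemma rel_ideal_P i j s f :
  (forall y, y \in s -> P i j y) -> rel_ideal s f -> P i j f.
Proof. by apply: (rel_ideal_sub (lin_idealP _)) => g /(_ i); exact: L_P. Qed.

Lemma colon_sub s t y f : (forall x, x \in t -> rel_ideal s (x * y)) ->
  rel_ideal t f -> rel_ideal s (f * y).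
Proof.
move=> ts; apply: (rel_ideal_sub (colon_idealP s y)) => // g Jg.
by apply: (ideal_mulr (rel_idealP s)); exact: rel_ideal0.
Qed.

Section Positions.
Variables i j k l m : 'I_5.
Hypothesis d : uniq [:: i; j; k; l; m].

(** Modular law: the triangle gives the intersection of [L i] and [L j], and the added edge [E i k]
    lies in [L j]. *)
Lemma pendant_ideal f :
  rel_ideal (E i k :: T k l m) f <-> L j f /\ P i k f.
Proof.
split_distinct d; split=> [Tf|[Lf /P_decomp[g fg]]].
  split; [apply: rel_ideal_L _ Tf | apply: rel_ideal_P _ Tf] => y;
    rewrite !inE => /or4P[]/eqP->; E_in_ideal.
exists g; apply/(triangle_ideal _ d); split=> //.
apply: (idealB (lin_idealP _)) => //.
by apply/(ideal_mull (lin_idealP _))/L_E; distinct.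
Qed.

Lemma pendants_ideal f :
  rel_ideal [:: E j k, E i k & T k l m] f <-> P i k f /\ P j k f.
Proof.
split_distinct d; split=> [Tf|[/P_decomp[g fg] Pf]].
  split; apply: rel_ideal_P _ Tf => y; rewrite !inE => /or4P[|||/orP[]] /eqP->;
    E_in_ideal.
have [h fh] : exists h, L j (f - g * E i k - h * E j k).
  apply: P_decomp; apply: (idealB (lin_idealP _)) => //.
  by apply/(ideal_mull (lin_idealP _))/L_P/L_E; distinct.
exists h, g; rewrite addrAC; apply/(triangle_ideal _ d); split=> //.
apply: (idealB (lin_idealP _)) => //.
by apply/(ideal_mull (lin_idealP _))/L_E; distinct.
Qed.

(** [Quad] consists of the edges on the four vertices other than [i], without [E j k]; that they
    suffice is [L_decomp]. *)
Lemma quad_ideal f : rel_ideal (Quad j k l m) f <-> L i f.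
Proof.
split=> [|/(L_decomp d)//]; split_distinct d.
by apply: rel_ideal_L => y; rewrite !inE => /or4P[|||/orP[]] /eqP->;
  E_in_ideal.
Qed.

Lemma quad_pendant_ideal f : rel_ideal (E i k :: Quad j k l m) f <-> P i k f.
Proof.
split=> [[g /quad_ideal fg]|/P_decomp[g fg]]; last by exists g; apply/quad_ideal.
rewrite -(subrK (g * E i k) f); apply: (idealD (lin_idealP _)); first exact: L_P.
exact/(ideal_mull (lin_idealP _))/P_E.
Qed.

(** [E k l] vanishes on the other three lines and cancels modulo [L k] and [L l], so the colon is
    their intersection. *)
Lemma colon_nil f : rel_ideal [::] (f * E k l) <-> rel_ideal (T i j m) f.
Proof.
have dkl : uniq [:: k; l; i; j; m] by split_distinct d; distinct.
rewrite (triangle_ideal f dkl) /=; split=> [Jf|[Lk Ll]].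
  split; first exact: L_prime dkl (Jf k).
  by apply: (@L_prime l k i j m); [split_distinct d; distinct | rewrite EC].
split_distinct d; apply: (lines_idealE d);
  first [exact: (ideal_mulr (lin_idealP _))
        |apply: (ideal_mull (lin_idealP _)); E_in_ideal].
Qed.

Lemma T_mul_pendant f : L i f -> rel_ideal (T k l m) (f * E i k).
Proof.
have d' : uniq [:: j; i; l; k; m] by split_distinct d; distinct.
by move=> Lf; apply: T_swap; exact: T_mul d' Lf.
Qed.

Lemma colon_triangle f : rel_ideal (T k l m) (f * E i k) <-> L i f.
Proof.
split=> [Tf|]; last exact: T_mul_pendant.
have d' : uniq [:: i; k; j; l; m] by split_distinct d; distinct.
by apply: (L_prime d'); have [] := proj1 (triangle_ideal _ d) Tf.
Qed.

Lemma colon_quad f : rel_ideal (Quad j k l m) (f * E i k) <-> L i f.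
Proof.
have d' : uniq [:: i; k; j; l; m] by split_distinct d; distinct.
rewrite quad_ideal; split; first exact: L_prime d'.
exact: (ideal_mulr (lin_idealP _)).
Qed.

Lemma colon_quad_pendant f :
  rel_ideal (E i k :: Quad j k l m) (f * E i l) <-> P i k f.
Proof.
have d' : uniq [:: i; l; k; j; m] by split_distinct d; distinct.
rewrite quad_pendant_ideal; split; first exact: P_prime d'.
exact: (ideal_mulr (lin_idealP _)).
Qed.

End Positions.

(** The right side is the intersection of [L m] and [P k l], which contain [E k l] and allow
    cancelling [E k m]. Conversely, the triangle on [l], [i], [j] is disjoint from [E k m]. *)
Lemma colon_edge i j k l m f : uniq [:: i; j; k; l; m] ->
  rel_ideal [:: E k l] (f * E k m) <-> rel_ideal (E k l :: T l i j) f.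
Proof.
move=> d.
have d1 : uniq [:: k; m; l; i; j] by split_distinct d; distinct.
have d2 : uniq [:: m; k; l; i; j] by split_distinct d; distinct.
rewrite (pendant_ideal d1); split=> [sf|].
  split; last first.
    apply: (P_prime d1); apply: rel_ideal_P _ sf => y.
    by rewrite inE => /eqP->; exact: P_E.
  apply: (L_prime d2); rewrite EC; apply: rel_ideal_L _ sf => y.
  by rewrite inE => /eqP->; split_distinct d; E_in_ideal.
move=> /(pendant_ideal d1); apply: colon_sub => y.
rewrite !inE => /or4P[]/eqP->.
- by apply: (ideal_mulr (rel_idealP _)); apply: rel_ideal_mem; rewrite inE.
- by apply: rel_ideal0; apply: (@E_mul0 i k j m l); split_distinct d; distinct.
- by apply: rel_ideal0; apply: (@E_mul0 l k j m i); split_distinct d; distinct.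
- by apply: rel_ideal0; apply: (@E_mul0 l k i m j); split_distinct d; distinct.
Qed.

(** Same pattern: the primes are [P l k] and [P m k], and the triangle on [k], [i], [j] is disjoint
    from [E l m]. *)
Lemma colon_path i j k l m f : uniq [:: i; j; k; l; m] ->
  rel_ideal [:: E k m; E k l] (f * E l m) <->
  rel_ideal [:: E m k, E l k & T k i j] f.
Proof.
move=> d.
have d1 : uniq [:: l; m; k; i; j] by split_distinct d; distinct.
have d2 : uniq [:: m; l; k; i; j] by split_distinct d; distinct.
rewrite (pendants_ideal d1); split=> [sf|].
  split; [apply: (P_prime d1) | apply: (P_prime d2); rewrite [E m l]EC];
  apply: rel_ideal_P _ sf => y; rewrite !inE => /orP[]/eqP->;
  rewrite EC; split_distinct d; E_in_ideal.
move=> /(pendants_ideal d1); apply: colon_sub => y.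
rewrite !inE => /or4P[|||/orP[]] /eqP->.
- apply: (ideal_mulr (rel_idealP _)); apply: rel_ideal_mem.
  by rewrite EC !inE eqxx.
- apply: (ideal_mulr (rel_idealP _)); apply: rel_ideal_mem.
  by rewrite EC !inE eqxx orbT.
- by apply: rel_ideal0; apply: (@E_mul0 i l j m k); split_distinct d; distinct.
- by apply: rel_ideal0; apply: (@E_mul0 k l j m i); split_distinct d; distinct.
- by apply: rel_ideal0; apply: (@E_mul0 k l i m j); split_distinct d; distinct.
Qed.

Lemma colon_pendant i j k l m f : uniq [:: i; j; k; l; m] ->
  rel_ideal (E i k :: T k l m) (f * E j k) <-> L j f.
Proof.
move=> d; have d1 : uniq [:: j; i; k; l; m] by split_distinct d; distinct.
have d2 : uniq [:: j; k; i; l; m] by split_distinct d; distinct.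
split=> [Tf|Lf]; last exact/rel_ideal_cons/(T_mul_pendant d1).
by apply: (L_prime d2); have [] := proj1 (pendant_ideal d _) Tf.
Qed.

(** Both sides equal [P j m]: [L j] times [E j l] falls into the triangle ideal by [T_mul], and
    [E j m] is a generator. *)
Lemma colon_half_quad i j k l m f : uniq [:: i; j; k; l; m] ->
  rel_ideal (E j m :: T k l m) (f * E j l) <->
  rel_ideal (E j m :: Quad i m l k) f.
Proof.
move=> d; have d1 : uniq [:: j; i; m; l; k] by split_distinct d; distinct.
have d2 : uniq [:: j; l; m; i; k] by split_distinct d; distinct.
rewrite (quad_pendant_ideal d1); split=> [Tf|/P_decomp[g fg]].
  apply: (P_prime d2); apply: rel_ideal_P _ Tf => y.
  by rewrite !inE => /or4P[]/eqP->; split_distinct d; E_in_ideal.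
exists (g * E j l).
have -> : f * E j l - g * E j l * E j m = (f - g * E j m) * E j l by ring.
exact: T_mul d fg.
Qed.

Lemma colon_triangle_last i j k l m f : uniq [:: i; j; k; l; m] ->
  rel_ideal (T k l m) (f * E j m) <-> L j f.
Proof.
move=> d; have d' : uniq [:: j; i; m; k; l] by split_distinct d; distinct.
rewrite -(colon_triangle d'); split=> [|/T_rotate//].
by move=> /T_rotate/T_rotate.
Qed.

(** Deleting the head edge stays in the family. The chain from the empty list through triangle and
    quad ends at the maximal ideal; the pendant graphs occur as colon ideals of its early steps. *)
Inductive fam : seq S -> Prop :=
| fam_nil : fam [::]
| fam_edge i j k l m of uniq [:: i; j; k; l; m] : fam [:: E k l]
| fam_path i j k l m of uniq [:: i; j; k; l; m] : fam [:: E k m; E k l]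
| fam_triangle i j k l m of uniq [:: i; j; k; l; m] : fam (T k l m)
| fam_pendant i j k l m of uniq [:: i; j; k; l; m] : fam (E i k :: T k l m)
| fam_half_quad i j k l m of uniq [:: i; j; k; l; m] :
    fam (E j m :: T k l m)
| fam_pendants i j k l m of uniq [:: i; j; k; l; m] :
    fam [:: E j k, E i k & T k l m]
| fam_quad i j k l m of uniq [:: i; j; k; l; m] : fam (Quad j k l m)
| fam_quad_pendant i j k l m of uniq [:: i; j; k; l; m] :
    fam (E i k :: Quad j k l m)
| fam_full i j k l m of uniq [:: i; j; k; l; m] :
    fam [:: E i l, E i k & Quad j k l m].

Lemma fam_cons y s : fam (y :: s) ->
  [/\ exists u, y = linear_form u, fam s &
      exists2 t, fam t & forall f, rel_ideal s (f * y) <-> rel_ideal t f].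
Proof.
move Es: (y :: s) => s' fs'; case: fs' Es => // i j k l m d [-> ->] {y s s'};
  (split; first by eexists).
(* For each nonempty constructor in turn, first the tail is placed in the family, then the colon
   ideal. *)
- exact: fam_nil.
- exists (T i j m); last by move=> f; exact: colon_nil d f.
  by apply: (@fam_triangle k l); split_distinct d; distinct.
- exact: fam_edge d.
- exists (E k l :: T l i j); last by move=> f; exact: colon_edge d.
  by apply: (@fam_pendant k m); split_distinct d; distinct.
- exact: fam_path d.
- exists [:: E m k, E l k & T k i j]; last by move=> f; exact: colon_path d.
  by apply: (@fam_pendants l m); split_distinct d; distinct.
- exact: fam_triangle d.
- exists (Quad j k l m); first exact: fam_quad d.
  by move=> f; rewrite (quad_ideal d) (colon_triangle d).
- exact: fam_triangle d.
- have d' : uniq [:: j; i; k; l; m] by split_distinct d; distinct.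
  exists (Quad i k l m); first exact: fam_quad d'.
  by move=> f; rewrite (quad_ideal d') (colon_triangle_last _ d).
- exact: fam_pendant d.
- have d' : uniq [:: j; i; k; l; m] by split_distinct d; distinct.
  exists (Quad i k l m); first exact: fam_quad d'.
  by move=> f; rewrite (quad_ideal d') (colon_pendant _ d).
- exact: fam_half_quad d.
- exists (E j m :: Quad i m l k); last by move=> f; exact: colon_half_quad d.
  by apply: (@fam_quad_pendant j i m l k); split_distinct d; distinct.
- exact: fam_quad d.
- exists (Quad j k l m); first exact: fam_quad d.
  by move=> f; rewrite (colon_quad d) (quad_ideal d).
- exact: fam_quad_pendant d.
- exists (E i k :: Quad j k l m); first exact: fam_quad_pendant d.
  by move=> f; rewrite (colon_quad_pendant d) (quad_pendant_ideal d).
Qed.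

Lemma full_ideal i j k l m d f : uniq [:: i; j; k; l; m] ->
  f \is d.+1.-homog -> rel_ideal [:: E i l, E i k & Quad j k l m] f.
Proof.
move=> dis /lin_ideal1_homog.
apply: (lin_ideal_sub (rel_idealP _)) => u _.
have dk : uniq [:: i; l; k; j; m] by split_distinct dis; distinct.
have [a [b uab]] := hyp_span u dk.
exists a%:MP, b%:MP; apply/(quad_ideal dis).
by rewrite !mul_mpolyC -!linearZ -!raddfB; exact: lin_ideal_mem.
Qed.
Lemma full_ideal_pihomog0 i j k l m f :
  rel_ideal [:: E i l, E i k & Quad j k l m] f -> pihomog mdeg 0 f = 0.
Proof.
move=> sf; apply: (@lin_ideal_pihomog0 _ _ _ (1%:M : 'M_7)).
apply: rel_ideal_sub sf; first exact: lin_idealP.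
  move=> g /(_ i); apply: (lin_ideal_sub (lin_idealP _)) => u _.
  exact/lin_ideal_mem/submx1.
move=> y; rewrite !inE => /orP[|/orP[|/orP[|/or4P[]]]] /eqP->;
  exact/lin_ideal_mem/submx1.
Qed.

End Configuration.

(** * The coordinate ring *)

Section Transfer.
Local Open Scope quotient_scope.
Variables (K : fieldType) (M : 'I_5 -> line K 6) (c : 'I_5 -> 'M[K]_(5, 7)).
Local Notation S := {mpoly K[7]}.

Hypothesis Mc : forall i p, defining_ideal (M i) p <-> lin_ideal (c i) p.

Local Notation A := (coordinate_ring M).
Local Notation gr := (coordinate_ring_grading M).
Local Notation pi := (\pi_{ideal_quot (collection_ideal M)} : S -> A).

Lemma pi_eq0 p : pi p = 0 <-> lines_ideal c p.
Proof.
have -> : pi p = 0 <-> p \in collection_ideal M.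
  have := Quotient.idealrBE (collection_ideal M) p 0.
  rewrite subr0 => ->; split=> [p0|/eqP->].
    by apply/eqP; rewrite p0 raddf0.
  exact: raddf0.
split=> [/asboolP Jp i|Jp]; first exact/Mc/Jp.
by apply/asboolP => i; apply/Mc; exact: Jp.
Qed.

Lemma in_ideal_pi s f : in_ideal (map pi s) (pi f) <-> rel_ideal c s f.
Proof.
elim: s f => [|y s IH] f /=; first exact: pi_eq0.
split=> [[a]|[a sf]].
  rewrite -[a]reprK -rmorphM -rmorphB => /IH sf.
  by exists (repr a).
by exists (pi a); rewrite -rmorphM -rmorphB; apply/IH.
Qed.

(** The relation is lifted to S, where it holds modulo J. Since J is homogeneous, the degree 2
    component of the relation also holds modulo J, with coefficients of degree 1. *)
Lemma gr1_lift p q (D : 'M[A]_(p, q)) (x : A) (r : 'rV_q) (a : 'rV_p) :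
  (forall i j, gr 1 (D i j)) -> gr 1 x -> (forall j, gr 1 (r 0 j)) ->
  x *: r = a *m D ->
  exists2 a' : 'rV_p, (forall j, gr 1 (a' 0 j)) & x *: r = a' *m D.
Proof.
move=> hD [x' hx' ->] hr Da.
exists (\row_j pi (pihomog mdeg 1 (repr (a 0 j)))) => [j|].
  by rewrite mxE; exists (pihomog mdeg 1 (repr (a 0 j))) => //; exact: pihomogP.
apply/rowP => s; have [r' hr' rE] := hr s.
have /choice[D' D'P] : forall j, exists D' : S, D' \is 1.-homog /\ D j s = pi D'.
  by move=> j; have [D' ? ?] := hD j s; exists D'.
have : lines_ideal c (x' * r' - \sum_j repr (a 0 j) * D' j).
  apply/pi_eq0; rewrite raddfB /= rmorphM raddf_sum /= -rE.
  have /rowP/(_ s) := Da; rewrite !mxE => ->; apply/eqP; rewrite subr_eq0.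
  apply/eqP/eq_bigr => j _.
  by rewrite rmorphM /= reprK (D'P j).2.
move=> Jx; have {}Jx : lines_ideal c
    (x' * r' - \sum_j pihomog mdeg 1 (repr (a 0 j)) * D' j).
  have -> : x' * r' = pihomog mdeg 2 (x' * r').
    by rewrite pihomog_dE //; exact: (dhomogM hx' hr').
  have -> : \sum_j pihomog mdeg 1 (repr (a 0 j)) * D' j =
            pihomog mdeg 2 (\sum_j repr (a 0 j) * D' j).
    rewrite raddf_sum; apply: eq_bigr => j _.
    by rewrite /= pihomogM_lin ?(D'P j).1.
  by rewrite -raddfB => i; apply: lin_ideal_pihomog; exact: Jx.
move/pi_eq0: Jx => /eqP; rewrite raddfB subr_eq0 => /eqP /=.
rewrite rmorphM raddf_sum /= -rE !mxE => ->; apply: eq_bigr => j _.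
by rewrite rmorphM mxE (D'P j).2.
Qed.

Hypothesis c_free : forall i, row_free (c i).
Hypothesis c_generic : forall i j k l m, uniq [:: i; j; k; l; m] ->
  forall u v : 'rV_7,
    (u <= c k)%MS -> (u <= c l)%MS -> (u <= c m)%MS ->
    (v <= c j)%MS -> (v <= c l)%MS -> (v <= c m)%MS ->
    ((u + v)%R <= c i)%MS -> u = 0 /\ v = 0.

Lemma koszul_of_configuration : koszul gr.
Proof.
pose Fam t := exists2 s, fam c s & t = map pi s.
have d : uniq [:: 0; 1; 2; 3; 4 : 'I_5] by [].
(* The list of [fam_full] for the indices 0 to 4 in order. *)
pose s := [:: linear_form (hyp c 0 3), linear_form (hyp c 0 2),
  linear_form (hyp c 1 3), linear_form (hyp c 1 4) &
  [:: linear_form (hyp c 3 4); linear_form (hyp c 2 4); linear_form (hyp c 2 3)]].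
have fs : fam c s by exact: fam_full d.
apply: (@koszul_of_filtration _ _ Fam _ _ _ _ (map pi s)).
- by exists 0; [exact: dhomog0 | rewrite raddf0].
- by move=> _ [p hp ->]; exists (- p); [rewrite rpredN | rewrite raddfN].
- exact: gr1_lift.
- move=> x t [[|y s'] // /(fam_cons c_free c_generic)[[u ->] fs' [t' ft' tt']] [-> ->]].
  split; first by exists (linear_form u); rewrite ?linear_form_homog.
    by exists s'.
  exists (map pi t'); first by exists t'.
  by move=> f; rewrite -[f]reprK -rmorphM !in_ideal_pi.
- by exists s.
move=> x; split=> [[r [a [ha ->]]]|].
  have /choice[p pP] : forall e : 'I_r, exists p : S, p \is e.+1.-homog /\ a e = pi p.
    by move=> e; have [p ? ?] := ha e; exists p.
  have -> : \sum_(e < r) a e = pi (\sum_e p e).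
    by rewrite raddf_sum; apply: eq_bigr => e _; exact: (pP e).2.
  apply/in_ideal_pi/(ideal_sum (rel_idealP c s)) => e _.
  exact: full_ideal d (pP e).1.
rewrite -[x]reprK; move: (repr x) => f /in_ideal_pi sf.
exists (msize f), (fun e => pi (pihomog mdeg e.+1 f)); split=> [e|].
  by exists (pihomog mdeg e.+1 f); first exact: pihomogP.
(* The bound is one more than [msize f], so that [msize f] components remain after the one of degree
   0, which vanishes, is split off. *)
rewrite -raddf_sum {1}(pihomog_partitionE (leqnSn (msize f))) big_ord_recl.
by rewrite (full_ideal_pihomog0 sf) add0r.
Qed.

End Transfer.

(** * Genericity *)

Section Genericity.

(** A determinant that is nonzero at one rational point is a nonzero polynomial, hence nonzero at
    algebraically independent values. *)
Lemma generic_nondegenerate (K : numFieldType) (T : finType) (x : T -> K)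
    (x0 : T -> rat) n (A : 'M[{mpoly rat[#|T|]}]_n) :
  algebraically_independent x ->
  (forall w : 'rV_n,
    w *m map_mx (meval (fun k => x0 (enum_val k))) A = 0 -> w = 0) ->
  forall w : 'rV_n,
    w *m map_mx (meval (fun k => x (enum_val k)) \o map_mpoly ratr) A = 0 -> w = 0.
Proof.
move=> ind A0 w wA.
have detA0 : \det (map_mx (meval (fun k => x0 (enum_val k))) A) != 0.
  by apply/negP => /det0P[v v0 /A0 v0']; rewrite v0' eqxx in v0.
have detA : \det A != 0.
  by apply: contraNneq detA0 => dA; rewrite det_map_mx dA raddf0.
have detx : \det (map_mx (meval (fun k => x (enum_val k)) \o map_mpoly ratr) A) != 0.
  by rewrite det_map_mx; apply: contra_neq detA => /ind.
apply/eqP; apply: contraNT detx => w0.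
by apply/det0P; exists w.
Qed.

(* The unknowns are the coefficients in
   [u = a_k *m Ck = a_l *m Cl = a_m *m Cm],
   [v = b_j *m Cj = b_l *m Cl = b_m *m Cm] and [u + v = g *m Ci];
   the five blocks of columns are the five equations between them. *)
Definition sysmx (R : nzRingType) (Ci Cj Ck Cl Cm : 'M[R]_(5, 7)) :=
  col_mx (row_mx Ck (row_mx 0 (row_mx 0 (row_mx 0 Ck))))
  (col_mx (row_mx (- Cl) (row_mx Cl (row_mx 0 (row_mx 0 0))))
  (col_mx (row_mx 0 (row_mx (- Cm) (row_mx 0 (row_mx 0 0))))
  (col_mx (row_mx 0 (row_mx 0 (row_mx Cj (row_mx 0 Cj))))
  (col_mx (row_mx 0 (row_mx 0 (row_mx (- Cl) (row_mx Cl 0))))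
  (col_mx (row_mx 0 (row_mx 0 (row_mx 0 (row_mx (- Cm) 0))))
          (row_mx 0 (row_mx 0 (row_mx 0 (row_mx 0 (- Ci))))))))))
  : 'M[R]_(5 + (5 + (5 + (5 + (5 + (5 + 5))))), 7 + (7 + (7 + (7 + 7)))).

Lemma map_sysmx (R R' : nzRingType) (f : {rmorphism R -> R'})
    (Ci Cj Ck Cl Cm : 'M[R]_(5, 7)) :
  map_mx f (sysmx Ci Cj Ck Cl Cm) =
  sysmx (map_mx f Ci) (map_mx f Cj) (map_mx f Ck) (map_mx f Cl) (map_mx f Cm).
Proof. by rewrite /sysmx !map_col_mx !map_row_mx !map_mx0 !map_mxN. Qed.

Lemma mul_sysmx (R : nzRingType) (Ci Cj Ck Cl Cm : 'M[R]_(5, 7))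
    (ak al am bj bl bm g : 'rV_5) :
  row_mx ak (row_mx al (row_mx am (row_mx bj (row_mx bl (row_mx bm g)))))
    *m sysmx Ci Cj Ck Cl Cm =
  row_mx (ak *m Ck - al *m Cl) (row_mx (al *m Cl - am *m Cm)
    (row_mx (bj *m Cj - bl *m Cl) (row_mx (bl *m Cl - bm *m Cm)
      (ak *m Ck + bj *m Cj - g *m Ci)))).
Proof.
rewrite /sysmx !mul_row_col !mul_mx_row !mulmx0 !add_row_mx !mulmxN.
by rewrite !(add0r, addr0) addrA.
Qed.

Definition nondegenerate (R : nzRingType) (Ci Cj Ck Cl Cm : 'M[R]_(5, 7)) : Prop :=
  forall w : 'rV_(_), w *m sysmx Ci Cj Ck Cl Cm = 0 -> w = 0.

Lemma nondegenerate_row_free (K : fieldType) (Ci Cj Ck Cl Cm : 'M[K]_(5, 7)) :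
  nondegenerate Ci Cj Ck Cl Cm -> row_free Ci.
Proof.
move=> nd; apply/inj_row_free => g g0.
have := nd (row_mx 0 (row_mx 0 (row_mx 0 (row_mx 0 (row_mx 0 (row_mx 0 g)))))).
rewrite mul_sysmx g0 !mul0mx !subr0 !addr0 !row_mx0.
by move/(_ erefl)/eqP; rewrite !row_mx_eq0 !eqxx => /eqP.
Qed.

Lemma nondegenerate_independent (K : fieldType) (Ci Cj Ck Cl Cm : 'M[K]_(5, 7))
    (u v : 'rV_7) : nondegenerate Ci Cj Ck Cl Cm ->
  (u <= Ck)%MS -> (u <= Cl)%MS -> (u <= Cm)%MS ->
  (v <= Cj)%MS -> (v <= Cl)%MS -> (v <= Cm)%MS ->
  ((u + v)%R <= Ci)%MS -> u = 0 /\ v = 0.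
Proof.
move=> nd /submxP[ak uk] /submxP[al ul] /submxP[am um].
move=> /submxP[bj vj] /submxP[bl vl] /submxP[bm vm] /submxP[g uv].
have := nd (row_mx ak (row_mx al (row_mx am (row_mx bj (row_mx bl (row_mx bm g)))))).
rewrite mul_sysmx -uk -ul -um -vj -vl -vm -uv !subrr !row_mx0 => /(_ erefl)/eqP.
rewrite !row_mx_eq0 => /andP[/eqP ak0 /andP[_ /andP[_ /andP[/eqP bj0 _]]]].
by rewrite uk vj ak0 bj0 !mul0mx.
Qed.

(** For five distinct indices below 7, the corresponding variables cut out the line joining the two
    remaining coordinate points. *)
Definition coord_mx (s : seq nat) : 'M[rat]_(5, 7) :=
  \matrix_(r, t) (nth 0%N s r == t)%:R.

Lemma coord_mx_notin s (a : 'rV_5) (t : 'I_7) :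
  size s = 5 -> (t : nat) \notin s -> (a *m coord_mx s) 0 t = 0.
Proof.
move=> s5 ts; rewrite mxE big1 // => r _; rewrite mxE.
case: eqP => [E|_]; last by rewrite mulr0.
by rewrite -E mem_nth ?s5 ?ltn_ord in ts.
Qed.

Lemma coord_mx_inj s (a : 'rV_5) : size s = 5 -> uniq s -> all (gtn 7) s ->
  a *m coord_mx s = 0 -> a = 0.
Proof.
move=> s5 us /allP s7 a0; apply/rowP => r.
have rs : (r < size s)%N by rewrite s5 ltn_ord.
have t7 : (nth 0%N s r < 7)%N by apply: s7; exact: mem_nth.
have /rowP/(_ (Ordinal t7)) := a0; rewrite !mxE (bigD1 r) //= mxE eqxx mulr1.
rewrite big1 ?addr0 // => q qr.
by rewrite mxE /= nth_uniq ?s5 ?ltn_ord // val_eqE (negPf qr) mulr0.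
Qed.

(** The first three lines are the sides of the triangle on the coordinate points 4, 5, 6; the others
    join 0 to 1 and 2 to 3. Then [u] is a multiple of x_6 and [v] of x_4, and neither variable
    occurs in the first matrix. *)
Lemma nondegenerate_coord :
  nondegenerate (coord_mx [:: 0; 1; 2; 3; 5]) (coord_mx [:: 0; 1; 2; 3; 4])
    (coord_mx [:: 0; 1; 2; 3; 6]) (coord_mx [:: 2; 3; 4; 5; 6])
    (coord_mx [:: 0; 1; 4; 5; 6]).
Proof.
move=> w; rewrite -[w]hsubmxK; move: (lsubmx w) (rsubmx w) => {w} ak w.
do 5! [rewrite -[w]hsubmxK; move: (lsubmx w) (rsubmx w) => {w} + w].
move=> bm bl bj am al; rewrite mul_sysmx => /eqP.
rewrite !row_mx_eq0 !subr_eq0.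
move=> /andP[/eqP kl /andP[/eqP lm /andP[/eqP jl /andP[/eqP lm' /eqP ijk]]]].
have ijkE t := congr1 (fun M : 'rV_7 => M 0 t) ijk.
have u0 : ak *m coord_mx [:: 0; 1; 2; 3; 6] = 0.
  apply/rowP => t; rewrite [RHS]mxE.
  have [tk|/coord_mx_notin->//] := boolP ((t : nat) \in [:: 0; 1; 2; 3; 6]).
  have [tl|/coord_mx_notin tl] := boolP ((t : nat) \in [:: 2; 3; 4; 5; 6]);
    last by rewrite kl tl.
  have [tm|/coord_mx_notin tm] := boolP ((t : nat) \in [:: 0; 1; 4; 5; 6]);
    last by rewrite kl lm tm.
  have := ijkE t; rewrite mxE (coord_mx_notin bj) ?(coord_mx_notin w) ?addr0 //;
    by move: tk tl tm; rewrite !inE; case: t => -[|[|[|[|[|[|[|]]]]]]].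
have v0 : bj *m coord_mx [:: 0; 1; 2; 3; 4] = 0.
  apply/rowP => t; rewrite [RHS]mxE.
  have [tk|/coord_mx_notin->//] := boolP ((t : nat) \in [:: 0; 1; 2; 3; 4]).
  have [tl|/coord_mx_notin tl] := boolP ((t : nat) \in [:: 2; 3; 4; 5; 6]);
    last by rewrite jl tl.
  have [tm|/coord_mx_notin tm] := boolP ((t : nat) \in [:: 0; 1; 4; 5; 6]);
    last by rewrite jl lm' tm.
  have := ijkE t; rewrite u0 add0r (coord_mx_notin w) //.
  by move: tk tl tm; rewrite !inE; case: t => -[|[|[|[|[|[|[|]]]]]]].
(* Once [u] and [v] vanish, every coefficient vector is killed by a coordinate matrix with
   independent rows. *)
move: ijk lm lm'; rewrite -kl -jl u0 v0 addr0 => /esym ijk /esym lm /esym lm'.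
rewrite (coord_mx_inj _ _ _ u0) // (coord_mx_inj _ _ _ v0) //.
rewrite (coord_mx_inj _ _ _ ijk) // (coord_mx_inj _ _ _ lm) //.
rewrite (coord_mx_inj _ _ _ lm') //.
rewrite (coord_mx_inj (a := al) _ _ _ (etrans (esym kl) u0)) //.
by rewrite (coord_mx_inj (a := bl) _ _ _ (etrans (esym jl) v0)) // !row_mx0.
Qed.

Lemma generic_sysmx (K : numFieldType) (c : 'I_5 -> 'M[K]_(5, 7)) i j k l m :
  uniq [:: i; j; k; l; m] ->
  algebraically_independent
    (fun t : 'I_5 * 'I_5 * 'I_7 => c t.1.1 t.1.2 t.2) ->
  nondegenerate (c i) (c j) (c k) (c l) (c m).
Proof.
move=> d ind.
(* The special lines are assigned by position in [[:: i; j; k; l; m]], so one example serves every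
   ordering. *)
pose c0 x := coord_mx (nth [::] [:: [:: 0; 1; 2; 3; 5]; [:: 0; 1; 2; 3; 4];
  [:: 0; 1; 2; 3; 6]; [:: 2; 3; 4; 5; 6]; [:: 0; 1; 4; 5; 6]]
  (index x [:: i; j; k; l; m]))%N.
pose C x : 'M[{mpoly rat[#|{: 'I_5 * 'I_5 * 'I_7}|]}]_(5, 7) :=
  \matrix_(r, t) 'X_(enum_rank (x, r, t)).
have ev0 x : map_mx (meval (fun a => let t := enum_val a in c0 t.1.1 t.1.2 t.2))
    (C x) = c0 x.
  by apply/matrixP => r t; rewrite !mxE mevalXU enum_rankK /= !mxE.
have ev x : map_mx (meval (fun a => let t := enum_val a in c t.1.1 t.1.2 t.2)
    \o map_mpoly ratr) (C x) = c x.
  by apply/matrixP => r t; rewrite !mxE /= map_mpolyX mevalXU enum_rankK.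
rewrite /nondegenerate -!ev -map_sysmx.
apply: (generic_nondegenerate (x0 := fun t => c0 t.1.1 t.1.2 t.2) ind).
move=> w; rewrite map_sysmx !ev0; move: w.
have idx q (q5 : (q < 5)%N) := index_uniq i (q5 : (q < size [:: i; j; k; l; m])%N) d.
rewrite /c0 (idx 0%N isT) (idx 1%N isT) (idx 2%N isT) (idx 3%N isT) (idx 4%N isT).
exact: nondegenerate_coord.
Qed.

End Genericity.

Lemma koszul_generic_lines (K : numFieldType) (M : 'I_5 -> line K 6) :
  generic_collection M -> koszul (coordinate_ring_grading M).
Proof.
case=> c [Mc ind]; have nd i j k l m d := @generic_sysmx _ c i j k l m d ind.
apply: (koszul_of_configuration (c := c)) => // [i|i j k l m d u v].
  (* Cyclic shifts of [i] modulo 5 supply the four other indices. *)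
  have d : uniq [:: i; i + 1; i + 2; i + 3; i + 4] by case: i => -[|[|[|[|[|]]]]].
  exact: nondegenerate_row_free (nd _ _ _ _ _ d).
exact: nondegenerate_independent (nd _ _ _ _ _ d).
Qed.

Theorem proposition4p10 (R : realType) (M : 'I_5 -> line (complex R) 6)
    (genM : generic_collection M) :
  koszul (coordinate_ring_grading M).
Proof. exact: koszul_generic_lines. Qed.
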